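(* Let $A$ be a primitive set and $p$ a prime, and let $A'_p=\{a\in A: p(a)=p\}$. If every prime dividing some element of $A'_p$ is a Zhang prime, then $f(A'_p)\le f(p)=1/(p\log p)$. Consequently, if $A$ is a primitive set all of whose elements have only Zhang primes as prime factors, then $f(A)\le\sum_{q\text{ prime}}\frac{1}{q\log q}$.
   Context: A set $A$ of integers greater than $1$ is primitive if no element of $A$ divides any other. For $a>1$, $p(a)$ is the least prime factor of $a$, $f(a)=1/(a\log a)$, and $f(A)=\sum_{a\in A}f(a)$. A prime $q$ is called a Zhang prime if $\sum_{p\ge q}\frac{1}{p\log p}\le\frac{1}{\log q}$, the sum being over primes $p\ge q$. *)

(* Defs.v *)
From HB Require Import structures.
From mathcomp Require Import all_boot all_order all_algebra.
From mathcomp Require Import all_classical all_reals all_analysis.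
Set Implicit Arguments.
Unset Strict Implicit.
Unset Printing Implicit Defensive.
Import Order.TTheory GRing.Theory Num.Theory.
Local Open Scope classical_set_scope.
Local Open Scope ring_scope.

Definition primitive (A : set nat) : Prop :=
  (forall a, A a -> (1 < a)%N) /\
  (forall a b, A a -> A b -> (a %| b)%N -> a = b).

(* Only meaningful for [1 < a]; every sum below ranges over such [a]. *)
Definition f (R : realType) (a : nat) : R := (a%:R * ln a%:R)^-1.

(* Taken in [0, +oo], so that no convergence has to be assumed. *)
Definition fsum (R : realType) (A : set nat) : \bar R :=
  (\esum_(a in A) (f R a)%:E)%E.

(* [pdiv a] is the least prime factor of [a] when [1 < a]. *)
Definition lpf_part (A : set nat) (p : nat) : set nat :=
  [set a | A a /\ pdiv a = p].

Definition zhang_prime (R : realType) (q : nat) : Prop :=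
  prime q /\ (fsum R [set p | prime p /\ (q <= p)%N] <= ((ln q%:R)^-1)%:E)%E.

(* Main.v *)
(** Say that [m] is a prefix of [a], with last prime [r], if [r] divides [m],
    [m] divides [a] and all primes of [a / m] are at least [r].  For a primitive
    set, the elements with prefix [(m, r)] have total weight at most
    [1 / (m log r)].  Indeed, if [m] is an element it is the only one, and
    [log r <= log m].  Otherwise each element has a prefix [(m q, q)], where
    [q >= r] is the least prime of [a / m]; by induction the total is at most
    the sum of [1 / (m q log q)] over the primes [q >= r], which the Zhang
    property of [r] bounds by [1 / (m log r)].  It is essential to keep [log r]
    rather than [log m] in the bound: with [log m] the induction breaks down. *)
Require Import Defs.
From mathcomp Require Import all_boot all_order all_algebra.
From mathcomp Require Import all_classical all_reals all_analysis.

Import Order.TTheory GRing.Theory Num.Theory.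
Local Open Scope classical_set_scope.
Local Open Scope ring_scope.

Lemma sum_nat_fibers (V : nmodType) (N : nat) (P : pred nat) (g : nat -> nat)
    (F : nat -> V) :
  (forall a, (a < N)%N -> P a -> (g a < N)%N) ->
  \sum_(0 <= a < N | P a) F a =
  \sum_(0 <= q < N) \sum_(0 <= a < N | P a && (g a == q)) F a.
Proof.
move=> gN; under [RHS]eq_bigr do rewrite big_mkcondr.
rewrite exchange_big /= big_nat_cond [RHS]big_nat_cond.
apply: eq_bigr => a /andP[/andP[_ aN] Pa].
rewrite (bigD1_seq (g a)) ?iota_uniq ?mem_index_iota ?gN //= eqxx.
rewrite big1 ?addr0 // => q /negPf qga.
by rewrite eq_sym qga.
Qed.

Section Weights.
Context {R : realType}.
Implicit Types A : set nat.

Lemma ln_nat_ge0 (n : nat) : 0 <= ln n%:R :> R.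
Proof. by case: n => [|n]; [rewrite ln0 | rewrite ln_ge0// ler1n]. Qed.

Lemma f_ge0 (a : nat) : 0 <= f R a.
Proof. by rewrite invr_ge0 mulr_ge0 ?ler0n ?ln_nat_ge0. Qed.

Lemma fsum_series A : fsum R A = (\sum_(0 <= a <oo | a \in A) (f R a)%:E)%E.
Proof.
rewrite nneseries_esum; last by move=> a _; rewrite lee_fin f_ge0.
by congr (esum _ _); apply/seteqP; split => a /=; rewrite inE.
Qed.

Lemma fsum_ge_partial A (N : nat) :
  ((\sum_(0 <= a < N | a \in A) f R a)%:E <= fsum R A)%E.
Proof.
rewrite fsum_series -sumEFin; apply: nneseries_lim_ge => a _ _.
by rewrite lee_fin f_ge0.
Qed.

(** Passes from infinite sums to truncations at [N], on which an induction can terminate. *)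
Lemma fsum_le A (x : \bar R) :
  (forall N, ((\sum_(0 <= a < N | a \in A) f R a)%:E <= x)%E) ->
  (fsum R A <= x)%E.
Proof.
move=> Ax; rewrite fsum_series; apply: lime_le.
  by apply: is_cvg_nneseries => a _ _; rewrite lee_fin f_ge0.
by apply: nearW => N; rewrite sumEFin.
Qed.

(** The condition [r %| m] is kept apart, as a hypothesis on the pair. For [a = m > 0] the cofactor
    is 1 and the second clause is vacuous. *)
Definition has_prefix (m r a : nat) : bool :=
  (m %| a)%N && all (fun q => r <= q)%N (primes (a %/ m)).

(** Since [a != m], the cofactor exceeds 1 and has a least prime [q]; by minimality, what remains
    after removing [q] has only primes at least [q]. The bound [q <= a] keeps [q] inside the
    truncated range. *)
Lemma has_prefix_pdiv (m r a : nat) :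
  (0 < a)%N -> a != m -> has_prefix m r a ->
  let q := pdiv (a %/ m) in
  [/\ prime q, (r <= q)%N, (q <= a)%N & has_prefix (m * q) q a].
Proof.
move=> a0 am /andP[/dvdnP[b aE] /allP/=]; subst a.
have [b0 m0] : (0 < b)%N /\ (0 < m)%N by apply/andP; rewrite -muln_gt0.
rewrite mulnK // => rb.
have b1 : (1 < b)%N.
  by rewrite ltn_neqAle b0 andbT; apply: contraNneq am => <-; rewrite mul1n.
have bq := pdiv_dvd b; have q_pr := pdiv_prime b1.
split=> //.
- by apply: rb; rewrite mem_primes q_pr b0.
- by rewrite (leq_trans (dvdn_leq b0 bq)) // leq_pmulr.
- rewrite /has_prefix [(b * m)%N]mulnC dvdn_pmul2l // bq /= divnMl //.
  apply/allP => s; rewrite mem_primes => /and3P[s_pr _ sb].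
  apply: pdiv_min_dvd; first exact: prime_gt1.
  by apply: dvdn_trans sb _; apply: dvdn_div.
Qed.

Lemma f_le_prefix (m r : nat) :
  prime r -> (0 < m)%N -> (r %| m)%N -> f R m <= (m%:R * ln r%:R)^-1.
Proof.
move=> r_pr m0 rm; have r1 := prime_gt1 r_pr.
have lnr : 0 < ln r%:R :> R by rewrite ln_gt0 // ltr1n.
have lnrm : ln r%:R <= ln m%:R :> R.
  have rmR : r%:R <= m%:R :> R by rewrite ler_nat; apply: dvdn_leq.
  by rewrite ler_ln // posrE ltr0n //; apply: prime_gt0.
have mR : 0 < m%:R :> R by rewrite ltr0n.
have lnm : 0 < ln m%:R :> R := lt_le_trans lnr lnrm.
by rewrite lef_pV2 ?ler_pM2l // posrE mulr_gt0.
Qed.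

Lemma sum_prefix_le A (N m r : nat) :
  primitive A ->
  (forall a q, A a -> prime q -> (q %| a)%N -> zhang_prime R q) ->
  prime r -> (0 < m)%N -> (r %| m)%N ->
  \sum_(0 <= a < N | (a \in A) && has_prefix m r a) f R a
    <= (m%:R * ln r%:R)^-1.
Proof.
move=> [A1 Aprim] Azhang.
(* Extending the prefix replaces [m] by [m * q > m], so [N - m] decreases as long as [m < N]. *)
have [n] := ubnP (N - m); elim: n m r => // n IH m r Nmn r_pr m0 rm.
have bound_ge0 : 0 <= (m%:R * ln r%:R)^-1 :> R.
  by rewrite invr_ge0 mulr_ge0 ?ler0n ?ln_nat_ge0.
(* Positive multiples of [m] are at least [m], so here no index below [N] contributes. *)
have [Nm|mN] := leqP N m.
  rewrite big_nat_cond big1 // => a /and3P[/andP[_ aN] aA /andP[ma _]].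
  have a0 : (0 < a)%N by rewrite (ltn_trans _ (A1 a (set_mem aA))).
  by have := leq_trans (leq_trans aN Nm) (dvdn_leq a0 ma); rewrite ltnn.
have [mA|mA] := boolP (m \in A).
  (* By primitivity only the term at [m] can survive. *)
  rewrite (eq_bigl (fun a => (a == m) && has_prefix m r m)); last first.
    move=> a; apply/andP/andP => [[aA pa]|[/eqP -> pm]] //.
    have am : m = a.
      by apply: Aprim (set_mem mA) (set_mem aA) _; case/andP: pa.
    by rewrite -am in pa *.
  rewrite big_mkcondr /= -big_filter filter_pred1_uniq ?iota_uniq //; last first.
    by rewrite mem_index_iota mN.
  by rewrite big_seq1; case: ifP => // _; apply: f_le_prefix.
(* Either the sum is empty, or some element [a] of [A] satisfies [r %| m %| a], which makes [r] a
   Zhang prime. *)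
have [/hasP[a _ /andP[aA /andP[ma _]]]|none] :=
    boolP (has (fun a => (a \in A) && has_prefix m r a) (index_iota 0 N)); last first.
  by rewrite big_hasC.
have [_ zr] : zhang_prime R r.
  by apply: (Azhang a) (set_mem aA) r_pr _; apply: dvdn_trans ma.
have part q : (m%:R * q%:R * ln q%:R)^-1 = m%:R^-1 * f R q.
  by rewrite -mulrA invfM.
rewrite (@sum_nat_fibers _ _ _ (fun a => pdiv (a %/ m))); last first.
  move=> b bN /andP[bA pb]; apply: leq_ltn_trans bN.
  have b1 : (1 < b)%N := A1 b (set_mem bA).
  have bm : b != m by apply: contraNneq mA => <-.
  by case: (has_prefix_pdiv _ _ _ (ltnW b1) bm pb).
apply: (@le_trans _ _
  (\sum_(0 <= q < N | q \in [set p | prime p /\ (r <= p)%N]) m%:R^-1 * f R q)).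
  rewrite [leRHS]big_mkcond; apply: ler_sum => q _.
  have sub b : (b \in A) && has_prefix m r b && (pdiv (b %/ m) == q) ->
      [/\ prime q, (r <= q)%N & (b \in A) && has_prefix (m * q) q b].
    move=> /andP[/andP[bA pb] /eqP <-].
    have b1 : (1 < b)%N := A1 b (set_mem bA).
    have bm : b != m by apply: contraNneq mA => <-.
    by case: (has_prefix_pdiv _ _ _ (ltnW b1) bm pb); split => //; apply/andP.
  case: ifPn => [|qr]; last first.
    rewrite big1 // => b /sub[q_pr rq _]; move: qr.
    by rewrite notin_setE /= => -[].
  rewrite inE /= => -[q_pr rq].
  (* The fibre over [q] is enlarged to all elements with prefix [(m * q, q)], the set that the
     induction hypothesis bounds. *)
  apply: (@le_trans _ _
    (\sum_(0 <= b < N | (b \in A) && has_prefix (m * q) q b) f R b)).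
    rewrite big_mkcond [leRHS]big_mkcond; apply: ler_sum => b _.
    by case: ifPn => [/sub[_ _ ->] //|_]; case: ifP => // _; apply: f_ge0.
  rewrite -part -natrM; apply: IH => //.
  - have lt_mq : (m < m * q)%N by rewrite ltn_Pmulr // prime_gt1.
    by rewrite (leq_trans _ (_ : N - m <= n)%N) // ltn_sub2l.
  - by rewrite muln_gt0 m0 prime_gt0.
  - exact: dvdn_mull.
(* After cancelling [1 / m], a partial sum of the Zhang series of [r] remains. *)
rewrite -mulr_sumr invfM ler_pM2l ?invr_gt0 ?ltr0n //.
by rewrite -lee_fin; apply: le_trans zr; apply: fsum_ge_partial.
Qed.

(** Every element with least prime [p] has prefix [(p, p)], and for [m = r = p] the prefix bound is
    exactly [f R p]. *)
Lemma sum_lpf_part_le A (N p : nat) :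
  primitive A -> prime p ->
  (forall a q, lpf_part A p a -> prime q -> (q %| a)%N -> zhang_prime R q) ->
  \sum_(0 <= a < N | a \in lpf_part A p) f R a <= f R p.
Proof.
move=> [A1 Aprim] p_pr Azhang.
have Bprim : primitive (lpf_part A p).
  by split=> [a [/A1]|a b [? _] [? _]] //; apply: Aprim.
have := @sum_prefix_le _ N p p Bprim Azhang p_pr (prime_gt0 p_pr) (dvdnn p).
congr (_ <= _); apply: eq_bigl => a; apply: andb_idr.
rewrite inE => -[/A1 a1 pa]; rewrite /has_prefix -{1}pa pdiv_dvd /=.
apply/allP => s; rewrite mem_primes => /and3P[s_pr _ sap].
rewrite -pa; apply: pdiv_min_dvd; first exact: prime_gt1.
by apply: dvdn_trans sap _; rewrite dvdn_div // -pa pdiv_dvd.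
Qed.

End Weights.

Theorem theorem5p1 (R : realType) :
  (forall (A : set nat) (p : nat),
     primitive A -> prime p ->
     (forall a q : nat, lpf_part A p a -> prime q -> (q %| a)%N ->
        zhang_prime R q) ->
     (fsum R (lpf_part A p) <= ((p%:R * ln p%:R)^-1)%:E)%E)
  /\
  (forall A : set nat,
     primitive A ->
     (forall a q : nat, A a -> prime q -> (q %| a)%N -> zhang_prime R q) ->
     (fsum R A <= \esum_(q in [set q : nat | prime q]) ((q%:R * ln q%:R)^-1)%:E)%E).
Proof.
split=> [A p Aprim p_pr Azhang|A Aprim Azhang].
  by apply: fsum_le => N; rewrite lee_fin; apply: sum_lpf_part_le.
(* Both sides are cut at the same [N]: the least prime of [a < N] is itself below [N]. Grouping by
   it leaves one instance of the first claim per prime. *)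
apply: fsum_le => N; apply: le_trans (fsum_ge_partial [set q | prime q] N).
have A1 a : a \in A -> (1 < a)%N by rewrite inE; apply: Aprim.1.
rewrite lee_fin (@sum_nat_fibers _ _ _ pdiv) => [|a aN /A1 a1]; last first.
  by rewrite (leq_ltn_trans (pdiv_leq (ltnW a1))).
rewrite [leRHS]big_mkcond; apply: ler_sum => q _.
case: ifPn => [|q_npr]; last first.
  rewrite big1 // => a /andP[/A1 a1 /eqP aq]; move: q_npr.
  by rewrite notin_setE /= -aq pdiv_prime.
rewrite inE /= => q_pr.
rewrite (eq_bigl (fun a => a \in lpf_part A q)) => [|a].
  by apply: sum_lpf_part_le => // a s [aA _]; apply: Azhang.
by apply/andP/idP; rewrite !inE => -[aA /eqP].
Qed.
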